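(* Let $K$ be a field and $S=K[x_1,\ldots,x_n]$. If $I\subset S$ is a monomial ideal of forest type, then $S/I$ is pretty clean.
   Context: For a monomial ideal $I$, $G(I)$ denotes its unique minimal set of monomial generators. Let $A$ be a nonempty finite set of monomials. An element $u\in A$ is called a leaf of $A$ if $u$ is the only element of $A$, or there exists $v\in A$, $v\ne u$, such that $\gcd(u,w)\mid\gcd(u,v)$ for all $w\in A$ with $w\neq u$. A monomial ideal $I$ is of forest type if every nonempty subset of $G(I)$ has a leaf. $S/I$ is pretty clean if it has a pretty clean filtration, i.e. a chain of ideals $I=I_0\subset I_1\subset\cdots\subset I_r=S$ such that (a) for all $j$ one has $I_j/I_{j-1}\cong S/P_j$, where $P_j$ is a monomial prime ideal (a prime ideal generated by a subset of the variables); (b) for all $i<j$, if $P_i\subset P_j$, then $P_i=P_j$. (If $I=S$ the trivial chain with $r=0$ is allowed.) *)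

(* Defs.v *)
From HB Require Import structures.
From mathcomp Require Import all_boot all_order all_algebra.
From mathcomp Require Import finmap mpoly.

Set Implicit Arguments.
Unset Strict Implicit.
Unset Printing Implicit Defensive.

Import GRing.Theory.
Local Open Scope ring_scope.
Local Open Scope quotient_scope.

Section QuotientModule.
Variables (R : pzRingType) (V : lmodType R) (N : submodClosed V).

(* The library has no canonical path from submodClosed to zmodClosed, over
   which quotients are built. *)
Lemma submod_zmod_closed : zmod_closed N.
Proof. exact/GRing.submod_closedB/submodClosedP. Qed.

Definition submod_zmod : zmodClosed V :=
  HB.pack (N : {pred V}) (GRing.isZmodClosed.Build V (N : {pred V}) submod_zmod_closed).

Definition quotmod := Quotient.quot submod_zmod.

HB.instance Definition _ := GRing.Zmodule.on quotmod.

Definition qscale (a : R) : quotmod -> quotmod := lift_op1 quotmod ( *:%R a).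

Lemma qscale_pi a v : qscale a (\pi_quotmod v) = \pi_quotmod (a *: v).
Proof.
rewrite /qscale; unlock; apply/eqP; rewrite -Quotient.idealrBE -scalerBr.
have: repr (\pi_quotmod v) - v \in submod_zmod.
  by rewrite Quotient.idealrBE reprK.
by move/(@rpredZ R V N a).
Qed.

Lemma qscaleA a b x : qscale a (qscale b x) = qscale (a * b) x.
Proof. by rewrite -[x]reprK !qscale_pi scalerA. Qed.

Lemma qscale1 : left_id 1 qscale.
Proof. by move=> x; rewrite -[x]reprK qscale_pi scale1r. Qed.

Lemma quot_piD : {morph \pi_quotmod : v w / v + w}.
Proof. exact: (@Quotient.pi_add _ submod_zmod). Qed.

Lemma qscaleDr : right_distributive qscale +%R.
Proof.
move=> a x y; rewrite -[x]reprK -[y]reprK.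
by rewrite -quot_piD !qscale_pi scalerDr quot_piD.
Qed.

Lemma qscaleDl x : {morph qscale^~ x : a b / a + b}.
Proof.
by move=> a b; rewrite -[x]reprK !qscale_pi scalerDl quot_piD.
Qed.

HB.instance Definition _ :=
  GRing.Zmodule_isLmodule.Build R quotmod qscaleA qscale1 qscaleDr qscaleDl.
End QuotientModule.

(* subquot M N is the quotient of M by its intersection with N, hence M / N when
   N is contained in M. *)
Section Subquotient.
Variables (R : pzRingType) (V : lmodType R) (M N : submodClosed V).

Definition submod := {x : V | x \in M}.
HB.instance Definition _ := [isSub for @sval V (fun x => x \in M) : submod -> V].
HB.instance Definition _ := [Choice of submod by <:].
HB.instance Definition _ := [SubChoice_isSubLmodule of submod by <:].

Definition restr_submod : {pred submod} := [pred x | \val x \in N].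

Lemma restr_submod_closed : subsemimod_closed restr_submod.
Proof.
split; first split; first exact: (@rpred0 V N).
- by move=> x y; exact: (@rpredD V N (\val x) (\val y)).
by move=> a x; exact: (@rpredZ R V N a (\val x)).
Qed.

HB.instance Definition _ :=
  GRing.isSubmodClosed.Build R submod restr_submod restr_submod_closed.

Definition subquot := quotmod restr_submod.
HB.instance Definition _ := GRing.Lmodule.on subquot.
End Subquotient.

Definition lmod_isomorphic (R : pzRingType) (V W : lmodType R) : Prop :=
  exists f : {linear V -> W}, bijective f.

Definition spans (R : pzRingType) (V : lmodType R) (G : V -> Prop) (x : V) :=
  exists s : seq (R * V),
    (forall p, p \in s -> G p.2) /\ x = \sum_(p <- s) p.1 *: p.2.

Section MonomialIdeals.
Variables (n : nat) (K : fieldType).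
Local Notation S := {mpoly K[n]}.

(* An ideal is an S-submodule of the regular module S^o; unlike the library's
   idealr, it may be all of S. *)
Definition ideal := submodClosed S^o.
Implicit Types (I : ideal) (G H : {pred 'X_{1..n}}).

Definition ideal_generated_by I (A : S -> Prop) : Prop :=
  forall f : S, f \in I <-> spans (V := S^o) A f.

Definition monomials G (f : S) : Prop := exists2 m, m \in G & f = 'X_[m].

Definition monomial_ideal I : Prop :=
  exists G, ideal_generated_by I (monomials G).

Definition minimal_monomial_generators I G : Prop :=
  ideal_generated_by I (monomials G) /\
  forall H, {subset H <= G} -> ideal_generated_by I (monomials H) -> H =i G.

Definition mgcd (u v : 'X_{1..n}) : 'X_{1..n} :=
  [multinom minn (u i) (v i) | i < n].

Local Open Scope fset_scope.

(* Divisibility of monomials is the pointwise order mnm_lepm. *)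
Definition leaf (A : {fset 'X_{1..n}}) (u : 'X_{1..n}) : Prop :=
  u \in A /\
  (A = [fset u] \/
   exists v, [/\ v \in A, v != u &
     forall w, w \in A -> w != u -> (mgcd u w <= mgcd u v)%MM]).

(* G(I) is finite (Dickson), so the finite sets A cover all its subsets. *)
Definition forest_type I : Prop :=
  forall G, minimal_monomial_generators I G ->
  forall A : {fset 'X_{1..n}}, A != fset0 -> {subset A <= G} ->
  exists u, leaf A u.

Definition monomial_prime (P : ideal) : Prop :=
  [/\ 1 \notin P, prime_idealr_closed P &
      exists V : {set 'I_n},
        ideal_generated_by P (fun f => exists2 i, i \in V & f = 'X_i)].

(* Only F 0, ..., F r and P 1, ..., P r matter. *)
Definition pretty_clean_filtration I (r : nat) (F P : nat -> ideal) : Prop :=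
  [/\ F 0%N =i I,
      F r =i predT,
      forall j, (j < r)%N -> {subset F j <= F j.+1},
      forall j, (0 < j <= r)%N ->
        monomial_prime (P j) /\
        lmod_isomorphic (subquot (F j) (F j.-1)) (quotmod (P j)) &
      forall i j, (0 < i)%N -> (i < j <= r)%N ->
        {subset P i <= P j} -> P i =i P j].

Definition pretty_clean I : Prop :=
  exists r F P, pretty_clean_filtration I r F P.

End MonomialIdeals.

(* Main.v *)
(** Order all data by monomials: a list of steps (m, V) is a filtration of S/I
    in which each new generator m has colon ideal P_V = (x_i : i in V).

    Let u be a leaf of the minimal generators and J the other ones. Some variable
    x_i divides u to a higher power than it divides any element of J. With
    u' = u / x_i, the ideal I + (u') = J + (u') is again of forest type (truncate
    the exponents of x_i), and so is J : u', while I : u' = (J : u') + (x_i).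
    Induction on the total degree of the generators therefore gives a filtration
    of S/I by steps (m, V).

    This filtration need not be pretty clean, but one may swap two consecutive
    steps (m, V), (m', V') with #|V| < #|V'|: this fails only if V' = V + {y} and
    m, m' agree on V, which a condition maintained along the induction excludes
    (the facets of the polarization form an antichain). Sorting the steps by
    decreasing height gives a pretty clean filtration. *)
Require Import Defs.
From HB Require Import structures.
From mathcomp Require Import all_boot all_order all_algebra.
From mathcomp Require Import finmap mpoly zify.
From Stdlib Require Import Classical_Prop.

Set Implicit Arguments.
Unset Strict Implicit.
Unset Printing Implicit Defensive.

(** * Sorting by exchanges of adjacent entries *)

Section Sorting.
Variables (T : eqType) (key : T -> nat) (C : seq T -> Prop).
Hypothesis swap : forall s1 a b s2,
  key a < key b -> C (s1 ++ a :: b :: s2) -> C (s1 ++ b :: a :: s2).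

Let decr a b := key b <= key a.

(** Insertion moves [a] past strictly larger keys only and stops at the first key that is at most
    its own, so every exchange is one that [swap] permits. *)
Lemma insert_by_swaps s1 a t : pairwise decr t -> C (s1 ++ a :: t) ->
  exists t', [/\ perm_eq (a :: t) t', pairwise decr t' & C (s1 ++ t')].
Proof.
elim: t s1 => [|b t IH] s1; first by exists [:: a].
move=> /= /andP[bt dt]; case: (leqP (key b) (key a)) => ab Ct.
  exists (a :: b :: t); split=> //=; rewrite bt dt !andbT {1}/decr ab /=.
  by apply/allP => x /(allP bt) xb; apply: leq_trans ab.
have [|t' [pt dt' Ct']] := IH (rcons s1 b) dt.
  by rewrite cat_rcons; apply: swap.
exists (b :: t'); rewrite -cat_rcons; split=> //=.
  rewrite -(perm_cons b) in pt; apply: perm_trans pt.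
  by rewrite (perm_catCA [:: a] [:: b]).
by rewrite dt' andbT -(perm_all _ pt) /= bt andbT; apply: ltnW.
Qed.

Lemma sort_by_swaps s : C s ->
  exists t, [/\ perm_eq s t, pairwise decr t & C t].
Proof.
suff: forall s1, C (s1 ++ s) ->
    exists t, [/\ perm_eq s t, pairwise decr t & C (s1 ++ t)] by move=> H; apply: (H [::]).
elim: s => [|a s IH] s1 Cs; first by exists [::].
have [|t [pt dt]] := IH (rcons s1 a); rewrite cat_rcons // => Ct.
have [t' [pt' dt' Ct']] := insert_by_swaps dt Ct.
by exists t'; split=> //; apply: perm_trans pt'; rewrite perm_cons.
Qed.

End Sorting.

(** * Filtrations as lists of steps *)

Section Combinatorics.
Variable n : nat.
Local Notation mon := 'X_{1..n}.
Implicit Types (G A : seq mon) (L : seq (mon * {set 'I_n})) (m f u w : mon).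
Implicit Types (V : {set 'I_n}) (p q : mon * {set 'I_n}).
Local Open Scope nat_scope.

(** On exponent vectors, [up G] is membership in the ideal (G), and [meets V] below is membership in
    the monomial prime P_V. *)
Definition up G f := has (fun w => (w <= f)%MM) G.

Definition meets V f := [exists i in V, 0 < f i].

Fixpoint steps G L : Prop :=
  if L is p :: L' then
    (forall f, up G (p.1 + f)%MM = meets p.2 f) /\ steps (p.1 :: G) L'
  else True.

Definition after G L := [seq p.1 | p <- L] ++ G.

Lemma upP G f : reflect (exists2 w, w \in G & (w <= f)%MM) (up G f).
Proof. exact: hasP. Qed.

Lemma up_le G f g : (f <= g)%MM -> up G f -> up G g.
Proof. by move=> fg /upP[w wG wf]; apply/upP; exists w => //; apply: lepm_trans fg. Qed.

Lemma up_sub G G' : {subset G <= G'} -> forall f, up G f -> up G' f.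
Proof. by move=> GG' f /upP[w wG wf]; apply/upP; exists w => //; apply: GG'. Qed.

Lemma meetsP V f : reflect (exists2 i, i \in V & 0 < f i) (meets V f).
Proof. exact: exists_inP. Qed.

Lemma steps_ext G G' L : up G =1 up G' -> steps G L -> steps G' L.
Proof.
elim: L G G' => //= p L IH G G' e [h1 h2]; split; first by move=> f; rewrite -e.
by apply: IH h2 => f; rewrite /up /=; congr (_ || _); apply: e.
Qed.

Lemma after_ext G G' L : up G =1 up G' -> up (after G L) =1 up (after G' L).
Proof. by move=> e f; rewrite /after /up !has_cat; congr (_ || _); apply: e. Qed.

Lemma up_after_cons G p L : up (after (p.1 :: G) L) =1 up (after G (p :: L)).
Proof. by move=> f; rewrite /after /up !has_cat /= -orbA orbCA. Qed.

Lemma steps_cat G L1 L2 :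
  steps G (L1 ++ L2) <-> steps G L1 /\ steps (after G L1) L2.
Proof.
elim: L1 G => [|p L1 IH] G /=; first by split => [|[]].
rewrite IH; split=> [[h1 [h2 h3]]|[[h1 h2] h3]]; do 2?split=> //.
  exact: steps_ext (up_after_cons _ _ _) h3.
by apply: steps_ext h3 => f; rewrite up_after_cons.
Qed.

Definition shift u i L := [seq ((u + p.1)%MM, i |: p.2) | p <- L].

(** Since (G) : u = (B) + (x_i), multiplication by u turns steps over (B) into steps over (G). The
    labels in [L] are free of x_i, so x_i is simply added to each prime. *)
Lemma steps_shift G B L u i :
  (forall f, up G (u + f)%MM = up B f || (0 < f i)) ->
  (forall p, p \in L -> p.1 i = 0) ->
  steps B L -> steps G (shift u i L).
Proof.
elim: L G B => //= p L IH G B e z [h1 h2]; split.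
  move=> f; rewrite -addmA e h1 mnmDE z ?mem_head // add0n.
  apply/orP/meetsP => [[/meetsP[j jV fj]|fi]|[j]].
  - by exists j => //; rewrite !inE jV orbT.
  - by exists i => //; rewrite !inE eqxx.
  rewrite !inE => /orP[/eqP-> -> |jV fj]; first by right.
  by left; apply/meetsP; exists j.
apply: IH h2; last by move=> q qL; apply: z; rewrite inE qL orbT.
move=> f; rewrite /up /= -/(up G _) -/(up B _) e orbA; congr (_ || _ || _).
by apply/mnm_lepP/mnm_lepP => h j; have := h j; rewrite !mnmDE leq_add2l.
Qed.

(* Under polarization a pair (m, V) is the facet ideal generated by the
   variables y_(i, m i + 1) for i in V; [fits] says that facets use existing
   variables only and [incomparable] that they form an antichain. *)
Definition fits A L := forall D : mon, (forall w, w \in A -> (w <= D)%MM) ->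
  forall p, p \in L -> (p.1 <= D)%MM /\ forall i, i \in p.2 -> p.1 i < D i.

Definition incomparable L := forall p q, p \in L -> q \in L ->
  p.2 \proper q.2 -> exists2 i, i \in p.2 & p.1 i <> q.1 i.

(** * Exchanging consecutive steps *)

Lemma mlcmE m m' i : mlcm m m' i = maxn (m i) (m' i).
Proof. exact: mnmE. Qed.

(** If lcm(m, m') lies in (G), adding m does not change the colon ideal of m', nor the reverse, so
    the steps commute. Otherwise the colon ideals force V' = V + {i} and m, m' agree on V, against
    the hypothesis. *)
Lemma steps_swap G p q L : #|p.2| < #|q.2| ->
  (p.2 \proper q.2 -> exists2 i, i \in p.2 & p.1 i <> q.1 i) ->
  steps G (p :: q :: L) -> steps G (q :: p :: L).
Proof.
case: p q => [m V] [m' V'] /= ltV inc [h1] [h2 h3].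
have up0 : up G (mlcm m m').
  apply/negPn/negP => nup.
  (* The lcm is a multiple of m, so lcm / m' lies in P_V'. *)
  have [i iV' mi] : exists2 i, i \in V' & m' i < m i.
    have : meets V' (mlcm m m' - m')%MM.
      by rewrite -h2 addmC submK ?lem_mlcmr //= lem_mlcml.
    case/meetsP => i iV'; rewrite mnmBE mlcmE => lt; exists i => //.
    by move: lt; lia.
  (* The lcm is not in (G), so lcm / m is not in P_V. *)
  have eV j : j \in V -> m' j <= m j.
    move=> jV; rewrite leqNgt; apply/negP => lt; case/negP: nup.
    rewrite -(submK (lem_mlcml m m')) addmC h1; apply/meetsP; exists j => //.
    by rewrite mnmBE mlcmE; lia.
  (* The product x_j m' lies in (m) + (G), and m does not divide it because of the exponent at i. *)
  have upU j : j != i -> j \in V' -> up G (m' + U_(j))%MM.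
    move=> ji jV'; have : meets V' U_(j) by apply/meetsP; exists j; rewrite // mnm1E eqxx.
    rewrite -h2 /= => /orP[/mnm_lepP/(_ i)|//].
    by rewrite mnmDE mnm1E (negbTE ji); lia.
  have lemm : (m <= m' + U_(i))%MM.
    have : meets V' U_(i) by apply/meetsP; exists i; rewrite // mnm1E eqxx.
    rewrite -h2 /= => /orP[//|] h; case/negP: nup; apply: up_le h.
    apply/mnm_lepP => j; rewrite mnmDE mnm1E mlcmE.
    by case: eqP => [<-|_]; lia.
  (* By [upU], x_j lcm / m lies in P_V; by [eV], lcm / m involves no variable of V, so x_j itself is
     one. *)
  have sV' : V' \subset i |: V.
    apply/subsetP => j jV'; rewrite !inE; case: (eqVneq j i) => //= ji.
    have : up G (m + (mlcm m m' - m + U_(j)))%MM.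
      rewrite addmA [(m + _)%MM]addmC submK ?lem_mlcml //.
      apply: up_le (upU j ji jV'); apply/mnm_lepP => k; rewrite !mnmDE mlcmE; lia.
    rewrite h1 => /meetsP[k kV]; rewrite mnmDE mnmBE mlcmE mnm1E.
    have := eV k kV; case: (eqVneq j k) => [->//|_] h1' h2'.
    by exfalso; move: h1' h2' => /=; lia.
  have niV : i \notin V.
    apply/negP => iV; have := subset_leq_card sV'.
    by rewrite cardsU1 iV add0n leqNgt ltV.
  have eV' : V' = i |: V.
    by apply/eqP; rewrite eqEcard sV' cardsU1 niV.
  have pV : V \proper V'.
    by rewrite eV' properEneq subsetU1 andbT; apply/eqP => h; rewrite h !inE eqxx in niV.
  have [j jV] := inc pV.
  have ij : i != j by apply: contraNneq niV => ->.
  by have := eV j jV; have /mnm_lepP/(_ j) := lemm; rewrite mnmDE mnm1E (negbTE ij); lia.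
have lcm_le a b : (a <= b)%MM -> up G (mlcm a b) -> up G b.
  by move=> ab; apply: up_le; rewrite lem_mlcm ab lepm_refl.
split.
  move=> f; rewrite -h2 /=; apply/idP/orP => [->|[h|//]]; first by right.
  by apply: up_le up0; rewrite lem_mlcm h lem_addr.
split.
  move=> f; rewrite -h1 /=; apply/orP/idP => [[h|//]|->]; last by right.
  by apply: up_le up0; rewrite lem_mlcm h lem_addr.
apply: steps_ext h3 => f; rewrite /up /=; by case: (m' <= f)%MM; rewrite ?orbT.
Qed.

Lemma steps_sort G L : steps G L -> incomparable L ->
  exists L', [/\ perm_eq L L', pairwise (fun p q => #|q.2| <= #|p.2|) L' & steps G L'].
Proof.
move=> sL iL.
have [||L' [h1 h2 [h3 _]]] :=
  @sort_by_swaps _ (fun p => #|p.2|) (fun L => steps G L /\ incomparable L) _ L.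
- move=> s1 p q s2 pq [/steps_cat[st1 st2] inc]; split.
    apply/steps_cat; split=> //; apply: steps_swap st2 => //.
    by apply: inc; rewrite mem_cat !inE eqxx ?orbT.
  have e : s1 ++ q :: p :: s2 =i s1 ++ p :: q :: s2.
    by move=> x; rewrite !mem_cat !inE; congr (_ || _); rewrite orbCA.
  by move=> x y; rewrite !e; apply: inc.
- by [].
by exists L'.
Qed.

(** * Forests of monomials *)

(** The lists met in the induction need not be minimal generating sets, so the condition is imposed
    on arbitrary lists. *)
Definition forest A := forall B : {fset mon}, B != fset0 ->
  {subset B <= A} -> exists u, leaf B u.

Lemma forest_sub A A' : {subset A' <= A} -> forest A -> forest A'.
Proof. by move=> s fA B B0 sB; apply: fA => // x /sB/s. Qed.

(** A map that is monotone in each exponent commutes with gcd and preserves divisibility. Choosing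
    one preimage [psi b] for each b in B, a leaf of the chosen set is sent to a leaf of B. *)
Lemma forest_map A (phi : 'I_n -> nat -> nat) :
  (forall i a b, a <= b -> phi i a <= phi i b) ->
  forest A -> forest [seq [multinom phi i (m i) | i < n] | m <- A].
Proof.
move=> mono fA B B0 sB; set Phi := fun m : mon => _ in sB.
have PhiE m i : Phi m i = phi i (m i) by rewrite mnmE.
pose psi b := nth 0%MM A (index b (map Phi A)).
have psiK b : b \in B -> psi b \in A /\ Phi (psi b) = b.
  move=> /sB bA; have lt : index b (map Phi A) < size A by rewrite -(size_map Phi) index_mem.
  by rewrite mem_nth //; split=> //; rewrite -(nth_map _ (Phi 0%MM)) // nth_index.
have [||u [/imfsetP[b /= bB ->] lf]] := fA [fset psi b | b in B]%fset.
- have /fset0Pn[b bB] := B0; apply/fset0Pn; exists (psi b).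
  by apply/imfsetP; exists b.
- by move=> x /imfsetP[b /= bB ->]; case: (psiK b bB).
exists b; split=> //; case: lf => [e|[v [/imfsetP[c /= cB ->] cb le]]].
  left; apply/fsetP => x; rewrite inE; apply/idP/eqP => [xB|->//].
  have : psi x \in [fset psi b | b in B]%fset by apply/imfsetP; exists x.
  by rewrite e inE => /eqP e'; rewrite -(psiK b bB).2 -e' (psiK x xB).2.
right; exists c; split=> // [|w wB wb].
  by apply: contraNneq cb => ->.
have wb' : psi w != psi b.
  by apply: contraNneq wb => e; rewrite -(psiK w wB).2 e (psiK b bB).2.
have wI : psi w \in [fset psi b | b in B]%fset by apply/imfsetP; exists w.
have /mnm_lepP lew := le _ wI wb'.
apply/mnm_lepP => i; have H := mono i _ _ (lew i).
rewrite -(psiK b bB).2 -(psiK c cB).2 -(psiK w wB).2; move: H.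
rewrite ![mgcd _ _ i]mnmE !PhiE.
have phimin x y : phi i (minn x y) = minn (phi i x) (phi i y).
  by case: (leqP x y) => [h|/ltnW h]; have := mono i _ _ h; [move/minn_idPl | move/minn_idPr].
by rewrite !phimin.
Qed.

(** * Induction along leaves *)

(** The second clause puts 1 in the last ideal, so the filtration reaches S. [incomparable] is what
    sorting requires, and [fits] helps to preserve it under gluing. *)
Definition clean_steps A L :=
  [/\ steps A L, up (after A L) 0%MM, fits A L & incomparable L].

(* Already f is in the ideal reached before the step (m, V), so f : m is in P_V. *)
Lemma steps_meets A L p f : steps A L -> p \in L -> up A f ->
  exists2 i, i \in p.2 & p.1 i < f i.
Proof.
move=> sL pL; move: (sL); case/splitPr: pL => L1 L2 /steps_cat[_ /= [h _]] uf.
have : up (after A L1) (p.1 + (f - p.1))%MM.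
  apply: (@up_le _ f); first by apply/mnm_lepP => i; rewrite mnmDE mnmBE; lia.
  by apply: up_sub uf => x xA; rewrite mem_cat xA orbT.
by rewrite h => /meetsP[i iV]; rewrite mnmBE => lt; exists i => //; lia.
Qed.

(* The hypotheses say that (A) : u = (B) + (x_i) and (A') = (A) + (u). *)
Lemma clean_steps_glue A B A' u i L1 L2 :
  (forall f, up A (u + f)%MM = up B f || (0 < f i)) ->
  (forall f, up A' f = up (u :: A) f) ->
  (forall w, w \in A' -> w i <= u i) ->
  (forall w, w \in B -> w i = 0) ->
  (forall D : mon, (forall w, w \in A -> (w <= D)%MM) ->
     [/\ (u + U_(i) <= D)%MM, forall w, w \in B -> (w <= D - u)%MM &
         forall w, w \in A' -> (w <= D)%MM]) ->
  clean_steps B L1 -> clean_steps A' L2 ->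
  clean_steps A (shift u i L1 ++ L2).
Proof.
move=> eB eA' lei B0 bd [s1 o1 f1 c1] [s2 o2 f2 c2].
pose D0 : mon := [multinom \max_(w <- A' ++ B) w j | j < n].
have leD0 w : w \in A' ++ B -> (w <= D0)%MM.
  move=> wA; apply/mnm_lepP => j; rewrite mnmE.
  exact: (leq_bigmax_seq (F := fun w : mon => w j)).
(* [fits] at D1 shows that L1 does not involve x_i, and at D2 that in L2 the
   label of x_i is at most u i. *)
pose D1 : mon := [multinom if j == i then 0 else D0 j | j < n].
have z1 p : p \in L1 -> p.1 i = 0 /\ i \notin p.2.
  move=> pL; have [|/mnm_lepP/(_ i) h1 h2] := f1 D1 _ p pL.
    move=> w wB; apply/mnm_lepP => j; rewrite mnmE; case: eqP => [->|_].
      by rewrite B0.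
    by apply/mnm_lepP/leD0; rewrite mem_cat wB orbT.
  by move: h1; rewrite mnmE eqxx leqn0 => /eqP h1; split=> //;
    apply/negP => /h2; rewrite mnmE eqxx.
pose D2 : mon := [multinom if j == i then u i else D0 j | j < n].
have z2 p : p \in L2 -> i \in p.2 -> p.1 i < u i.
  move=> pL; have [|_ h2] := f2 D2 _ p pL; last first.
    by move/h2; rewrite mnmE eqxx.
  move=> w wA; apply/mnm_lepP => j; rewrite mnmE; case: eqP => [->|_].
    exact: lei.
  by apply/mnm_lepP/leD0; rewrite mem_cat wA.
(* The shifted steps end exactly at (A) + (u) = (A'), where [L2] starts. *)
have upsh : up (after A (shift u i L1)) =1 up A'.
  have uin : up (after A (shift u i L1)) u.
    case/upP: o1 => w; rewrite mem_cat => /orP[/mapP[p pL ->] w0|wB w0].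
      apply/upP; exists (u + p.1)%MM.
        by rewrite mem_cat; apply/orP; left; rewrite -map_comp; apply/mapP; exists p.
      apply/mnm_lepP => j; have /mnm_lepP/(_ j) := w0.
      by rewrite /= mnmDE mnm0E; lia.
    apply: (@up_sub A); first by move=> x xA; rewrite mem_cat xA orbT.
    by rewrite -[u]addm0 eB; apply/orP; left; apply/upP; exists w.
  move=> f; rewrite eA'; apply/idP/idP => /upP[w].
    rewrite mem_cat => /orP[/mapP[q /mapP[p pL ->] ->] wf|wA wf].
      apply/upP; exists u; rewrite ?mem_head //.
      by apply: lepm_trans wf; apply: lem_addr.
    by apply/upP; exists w; rewrite // inE wA orbT.
  rewrite inE => /orP[/eqP -> uf|wA wf]; first exact: up_le uin.
  by apply/upP; exists w; rewrite // mem_cat wA orbT.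
split.
- apply/steps_cat; split; last by apply: steps_ext s2.
  by apply: steps_shift s1 => // p /z1[].
- rewrite (_ : up _ _ = up (after (after A (shift u i L1)) L2) 0%MM).
    by rewrite (after_ext _ upsh).
  by apply/upP/upP => -[w wG w0]; exists w => //; move: wG;
    rewrite /after map_cat !mem_cat orbCA orbA.
(* D - u bounds B, so [f1] applies to it; the added variable x_i is covered because u x_i divides
   D. *)
- move=> D leD p; rewrite mem_cat; have [uD BD AD] := bd D leD => /orP[|/f2]; last exact.
  have /mnm_lepP uD' := uD.
  case/mapP => q qL ->; have [/mnm_lepP h1 h2] := f1 _ BD q qL; split=> /=.
    apply/mnm_lepP => j; have := h1 j; have := uD' j.
    by rewrite !mnmDE mnmBE mnm1E; lia.
  move=> j; rewrite !inE => /orP[/eqP ->|/h2].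
    by have := uD' i; rewrite !mnmDE mnm1E eqxx (z1 _ qL).1; lia.
  by rewrite mnmBE mnmDE; lia.
(* Both from [L1]: the added i and u cancel. From [L1] and [L2]: the labels differ at i, being u i
   for p and smaller for q. From [L2] and [L1]: u lies in (A'), so p is below u at some variable of
   its prime, while q is a multiple of u. Both from [L2]: by [c2]. *)
move=> p q; rewrite !mem_cat => /orP[] pL /orP[] qL pq.
- case/mapP: pL pq => {}p pL ->; case/mapP: qL => {}q qL -> /= pq.
  have [_ ip] := z1 _ pL; have [_ iq] := z1 _ qL.
  have [|j jp ne] := c1 p q pL qL.
    have [/subsetP sub [k kq kp]] := properP pq; apply/properP; split.
      apply/subsetP => j jp; have := sub j; rewrite !inE jp orbT => /(_ isT).
      by case/orP=> // /eqP e; rewrite -e jp in ip.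
    move: kq kp; rewrite !inE negb_or => kq /andP[ki kp]; exists k => //.
    by rewrite (negbTE ki) in kq.
  by exists j; [rewrite !inE jp orbT | rewrite !mnmDE => /addnI].
- case/mapP: pL pq => {}p pL -> /= pq; exists i; first by rewrite !inE eqxx.
  have iq : i \in q.2 by apply: (subsetP (proper_sub pq)); rewrite !inE eqxx.
  by rewrite mnmDE (z1 _ pL).1 => e; have := z2 q qL iq; lia.
- case/mapP: qL pq => {}q qL -> /= pq.
  have [|j jp lt] := steps_meets s2 pL (f := u).
    by rewrite eA' /up /= lepm_refl.
  by exists j => // e; move: lt; rewrite e mnmDE; lia.
exact: c2.
Qed.

Definition total_degree A := \sum_(w <- A) mdeg w.

Lemma total_degree_map A (phi : mon -> mon) :
  (forall w, mdeg (phi w) <= mdeg w) ->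
  total_degree (map phi A) <= total_degree A.
Proof. by move=> h; rewrite /total_degree big_map; apply: leq_sum => w _; apply: h. Qed.

Lemma total_degree_remove A u : u \in A ->
  mdeg u + total_degree [seq w <- A | w != u] <= total_degree A.
Proof.
move=> uA; rewrite /total_degree big_filter.
rewrite !(perm_big _ (perm_to_rem uA)) !big_cons eqxx /= leq_add2l.
by rewrite big_mkcond leq_sum // => w _; case: ifP.
Qed.

Lemma lepmPn m m' : ~~ (m <= m')%MM -> exists i, m' i < m i.
Proof.
move=> h; apply/existsP; apply: contraNT h; rewrite negb_exists => /forallP h.
by apply/mnm_lepP => i; rewrite leqNgt.
Qed.

(** Dropping a redundant generator keeps the ideal, and [fits] for fewer generators is the stronger
    condition. *)
Lemma clean_steps_remove A u w : u \in A -> w != u -> w \in A -> (w <= u)%MM ->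
  (exists L, clean_steps [seq w <- A | w != u] L) -> exists L, clean_steps A L.
Proof.
move=> uA wu wA le [L [s o f c]].
have sub : {subset [seq w <- A | w != u] <= A} by move=> x; rewrite mem_filter => /andP[].
have e : up [seq w <- A | w != u] =1 up A.
  move=> x; apply/idP/idP; first exact: up_sub.
  case/upP=> v vA vx; apply/upP; case: (eqVneq v u) vx => [-> ux|vu vx].
    by exists w; [rewrite mem_filter wu | apply: lepm_trans ux].
  by exists v => //; rewrite mem_filter vu.
exists L; split=> //; [exact: steps_ext s | by rewrite -(after_ext _ e) |].
by move=> D leD; apply: f => v /sub; apply: leD.
Qed.

(** By minimality u does not divide v, so u exceeds v at some i; as gcd(u, w) divides gcd(u, v),
    every other w is also below u at i. If u is alone, any variable dividing u will do. *)
Lemma leaf_free_variable A u : {in A &, forall v w, (v <= w)%MM -> v = w} ->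
  0%MM \notin A -> leaf [fset w in A]%fset u ->
  exists i, 0 < u i /\ {in A, forall w, w != u -> w i < u i}.
Proof.
move=> anti A0 [uA]; rewrite !inE /= in uA; case=> [e|[v [vA vu le]]].
  have [|i] := @lepmPn u 0%MM.
    apply: contraNN A0 => u0; suff <- : u = 0%MM by [].
    by apply/mnmP => i; apply/eqP; rewrite mnm0E -leqn0 -(mnm0E i); apply/mnm_lepP.
  rewrite mnm0E => ui; exists i; split=> // w wA wu.
  have : w \in [fset w in A]%fset by rewrite inE.
  by rewrite e inE (negbTE wu).
rewrite !inE /= in vA; have [|i lti] := @lepmPn u v.
  by apply: contra_neqN vu => uv; rewrite (anti u v).
exists i; split=> [|w wA wu]; first exact: leq_ltn_trans lti.
have wA' : w \in [fset w in A]%fset by rewrite inE.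
by have /mnm_lepP/(_ i) := le w wA' wu; rewrite ![mgcd _ _ i]mnmE; lia.
Qed.

Theorem forest_clean_steps A : forest A -> exists L, clean_steps A L.
Proof.
have [d] := ubnP (total_degree A); elim: d A => // d IH A ltd fA.
have [A0|A0] := boolP (0%MM \in A).
  exists [::]; split=> //.
  by apply/upP; exists 0%MM; rewrite ?lepm_refl.
have Apos w : w \in A -> 0 < mdeg w.
  by move=> wA; rewrite lt0n mdeg_eq0; apply: contraNneq A0 => <-.
have [e|An0] := eqVneq A [::].
  (* For the zero ideal, a single step suffices: the generator 1 with the zero prime. *)
  rewrite {}e; exists [:: (0%MM, set0)]; split=> //=.
  - split=> // f; rewrite /up /=; apply/esym/negbTE/negP.
    by case/meetsP=> i; rewrite inE.
  - by rewrite /up /= lepm_refl.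
  - move=> D _ p; rewrite inE => /eqP -> /=; split=> [|i]; last by rewrite inE.
    by apply/mnm_lepP => i; rewrite mnm0E.
  by move=> p q; rewrite !inE => /eqP -> /eqP -> /=; rewrite properxx.
(* A list that is not an antichain has a redundant generator; it differs from 1, so its removal
   lowers the total degree. *)
have [anti|] := boolP (all (fun v => all (fun w => (v <= w)%MM ==> (v == w)) A) A); last first.
  case/allPn=> w wA /allPn[u uA]; rewrite negb_imply => /andP[le wu].
  apply: (@clean_steps_remove A u w) => //; apply: IH.
    have := total_degree_remove uA; have := Apos u uA; rewrite ltnS in ltd; lia.
  by apply: forest_sub fA => x; rewrite mem_filter => /andP[].
have {}anti : {in A &, forall v w, (v <= w)%MM -> v = w}.
  by move=> v w /(allP anti)/allP h /h /implyP h' /h' /eqP.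
have [||u lf] := fA [fset w in A]%fset.
- by case: (A) An0 => // a l _; apply/fset0Pn; exists a; rewrite !inE eqxx.
- by move=> x; rewrite inE.
have [i [ui lti]] := leaf_free_variable anti A0 lf.
have uA : u \in A by case: lf; rewrite inE.
pose J := [seq w <- A | w != u]; pose u' := (u - U_(i))%MM.
have JA : {subset J <= A} by move=> x; rewrite mem_filter => /andP[].
have uE : (u' + U_(i))%MM = u.
  by apply/mnmP => j; rewrite mnmDE mnmBE mnm1E; case: eqP => [<-|_]; lia.
have u'E j : u' j = u j - (i == j) by rewrite mnmBE mnm1E.
have ltJ w : w \in J -> w i <= u' i.
  rewrite mem_filter u'E eqxx => /andP[wu wA]; have := lti w wA wu; lia.
have degJ : mdeg u + total_degree J <= total_degree A by apply: total_degree_remove.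
have degu : (mdeg u' + 1)%N = mdeg u by rewrite -[in RHS]uE mdegD mdeg1.
(* Truncated subtraction gives w / gcd(w, u'), and these generate J : u'. They are free of x_i
   because w i <= u' i on J. *)
have [|| L1 c1] := IH [seq (w - u')%MM | w <- J].
- have := @total_degree_map J (fun w => w - u')%MM (fun w => mdegB w u').
  rewrite ltnS in ltd; lia.
- have -> : [seq (w - u')%MM | w <- J] =
      [seq [multinom w j - u' j | j < n] | w <- J].
    by apply: eq_map => w; apply/mnmP => j; rewrite mnmBE mnmE.
  apply: (@forest_map J (fun j a => a - u' j)) (forest_sub JA fA).
  by move=> j a b ab; apply: leq_sub2r.
have [|| L2 c2] := IH (u' :: J).
- rewrite /total_degree big_cons -/(total_degree J); rewrite ltnS in ltd; lia.
(* Capping the exponent of x_i at u' i sends u to u' and fixes J. *)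
- have fA' := @forest_map A (fun j a => if j == i then minn a (u' i) else a) _ fA.
  apply: forest_sub (fA' _); last first.
    by move=> j a b ab; case: ifP => // _; lia.
  move=> w; rewrite inE => wJ; apply/mapP; case/orP: wJ => [/eqP -> | wJ].
    exists u => //; apply/mnmP => j; rewrite mnmE !u'E eqxx eq_sym.
    by case: (eqVneq j i) => [->|_]; lia.
  exists w; first exact: JA.
  by apply/mnmP => j; rewrite mnmE; case: eqP => [->|//]; have := ltJ w wJ; lia.
exists (shift u' i L1 ++ L2); apply: clean_steps_glue c1 c2.
(* Here (A) : u' = (J : u') + (x_i), the last term coming from u = u' x_i. *)
- have cond w f : (w <= u' + f)%MM = (w - u' <= f)%MM.
    by apply/mnm_lepP/mnm_lepP => h j; have := h j; rewrite mnmDE mnmBE; lia.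
  have condu f : (u <= u' + f)%MM = (0 < f i).
    apply/mnm_lepP/idP => [/(_ i)|h j]; rewrite mnmDE u'E; first by rewrite eqxx; lia.
    by case: eqP => [<-|_]; lia.
  move=> f; apply/upP/orP => [[w wA]|[/upP[w' /mapP[w wJ ->]]|fi]].
  + case: (eqVneq w u) => [->|wu]; first by rewrite condu; right.
    rewrite cond => wf; left; apply/upP; exists (w - u')%MM => //.
    by apply/mapP; exists w => //; rewrite mem_filter wu.
  + by rewrite -cond => wf; exists w => //; apply: JA.
  + by exists u; rewrite ?condu.
- move=> f; apply/idP/idP => /upP[w]; rewrite inE => /orP[/eqP-> wf|wJ wf].
  + by apply/upP; exists u'; rewrite ?mem_head.
  + by apply/upP; exists w => //; rewrite inE JA ?orbT.
  + by apply/upP; exists u'; rewrite ?mem_head.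
  + case: (eqVneq w u) wf => [->|wu] wf; apply/upP.
      exists u'; rewrite ?mem_head //; apply: lepm_trans wf.
      by rewrite -uE lem_addr.
    by exists w => //; rewrite inE mem_filter wu wJ orbT.
- by move=> w; rewrite inE => /orP[/eqP->|/ltJ].
- by move=> w /mapP[w' /ltJ h ->]; rewrite mnmBE; lia.
move=> D leD; rewrite uE; split; first exact: leD.
  move=> w /mapP[w' /JA/leD/mnm_lepP h ->]; apply/mnm_lepP => j.
  by rewrite !mnmBE; have := h j; lia.
move=> w; rewrite inE => /orP[/eqP->|/JA/leD//].
by apply: lepm_trans (leD u uA); rewrite -uE lem_addr.
Qed.

End Combinatorics.
Import GRing.Theory.
Local Open Scope ring_scope.

(** * Isomorphisms of quotient modules *)

Section Projection.
Variables (R : pzRingType) (V : lmodType R) (N : submodClosed V).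
Local Open Scope quotient_scope.

Definition qproj (x : V) : quotmod N := \pi_(quotmod N) x.

Lemma qprojD x y : qproj (x + y) = qproj x + qproj y.
Proof. exact: quot_piD. Qed.

Lemma qprojZ a x : qproj (a *: x) = a *: qproj x.
Proof. by rewrite /qproj -qscale_pi. Qed.

Lemma qproj_eq (x y : V) : reflect (qproj x = qproj y) (x - y \in N).
Proof.
rewrite (_ : (x - y \in N) = (x - y \in submod_zmod N)) // Quotient.idealrBE.
exact: eqP.
Qed.

Lemma qproj_repr (y : quotmod N) : qproj (repr y) = y.
Proof. exact: reprK. Qed.
End Projection.

Section QuotientIso.
Variables (R : pzRingType) (V U : lmodType R) (M N : submodClosed V) (P : submodClosed U).

(** [phi] induces an isomorphism from U / P onto [subquot M N]. The required map goes the other way,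
    so it is built from chosen lifts; [liftE] shows that the choice is irrelevant modulo P, whence
    linearity. *)
Lemma subquot_isomorphic (phi : {linear U -> V}) :
  (forall u, phi u \in M) -> (forall u, (phi u \in N) = (u \in P)) ->
  (forall x, x \in M -> exists u, x - phi u \in N) ->
  lmod_isomorphic (subquot M N) (quotmod P).
Proof.
move=> phiM phiN surj.
pose Q : submodClosed (submod M) := restr_submod N.
pose lift (x : submod M) := xchoose (surj _ (valP x)).
pose psi u : submod M := Sub (phi u) (phiM u).
have psiK (y : subquot M N) : qproj Q (psi (lift (repr y))) = y.
  rewrite -[RHS]qproj_repr; apply/esym/qproj_eq.
  by rewrite inE raddfB /=; apply: (xchooseP (surj _ (valP (repr y)))).
have liftE (y : subquot M N) u : qproj Q (psi u) = y -> qproj P (lift (repr y)) = qproj P u.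
  rewrite -[in X in X -> _](psiK y) => /esym/qproj_eq; rewrite inE raddfB /=.
  by rewrite -raddfB phiN => /qproj_eq.
pose f (y : subquot M N) : quotmod P := qproj P (lift (repr y)).
have f_lin : linear f.
  move=> a x y; rewrite /f -qprojZ -qprojD; apply: liftE.
  rewrite (_ : psi _ = a *: psi (lift (repr x)) + psi (lift (repr y))).
    by rewrite qprojD qprojZ !psiK.
  by apply: val_inj; rewrite raddfD [X in _ = X + _]linearZ /= linearP.
pose F : {linear subquot M N -> quotmod P} :=
  HB.pack f (GRing.isLinear.Build R (subquot M N) (quotmod P) *:%R f f_lin).
exists F, (fun z => qproj Q (psi (repr z))) => [y|z]; last first.
  by rewrite /= /f -[RHS]qproj_repr; apply: liftE.
rewrite -[RHS]psiK; apply/qproj_eq; rewrite inE raddfB /= -raddfB phiN.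
by apply/qproj_eq; rewrite qproj_repr.
Qed.
End QuotientIso.

(** * From step lists to ideals and filtrations *)

Section MonomialIdealsOfSeq.
Variables (n : nat) (K : fieldType).
Local Notation mon := 'X_{1..n}.
Local Notation S := {mpoly K[n]}.
Implicit Types (G : seq mon) (f g : S) (m : mon) (V : {set 'I_n}).

(** A polynomial lies in a monomial ideal exactly when all its monomials do. This makes membership
    boolean; [mon_ideal_generated] recovers the description by generators. *)
Definition mon_ideal_pred G : {pred S^o} := [pred f : S | all (up G) (msupp f)].

Lemma mon_ideal_subproof G : GRing.subsemimod_closed (mon_ideal_pred G).
Proof.
split; first split; first by rewrite inE /= msupp0.
  move=> f g /allP fG /allP gG; apply/allP => m /msuppD_le.
  by rewrite mem_cat => /orP[/fG|/gG].
move=> a f /allP fG; apply/allP => m /msuppM_le/allpairsP[[k l] [_ lf ->]].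
by apply: up_le (fG _ lf); rewrite lem_addl.
Qed.

HB.instance Definition _ G :=
  GRing.isSubmodClosed.Build S S^o (mon_ideal_pred G) (mon_ideal_subproof G).

Definition mon_ideal G : ideal n K := mon_ideal_pred G.

Lemma mon_idealE G f : (f \in mon_ideal G) = all (up G) (msupp f).
Proof. by []. Qed.

Lemma mem_mon_idealX G m : ('X_[m] \in mon_ideal G) = up G m.
Proof. by rewrite mon_idealE msuppX /= andbT. Qed.

Lemma mpoly_term_ind (Q : S -> Prop) f :
  Q 0 -> (forall g h, Q g -> Q h -> Q (g + h)) ->
  (forall m, m \in msupp f -> Q (f@_m *: 'X_[m])) -> Q f.
Proof.
move=> Q0 QD Qm; rewrite [f]mpolyE big_seq; exact: big_ind.
Qed.

Lemma spans_monomialsP (H : {pred mon}) f :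
  spans (V := S^o) (monomials (K := K) H) f <->
  forall m, m \in msupp f -> exists2 h, h \in H & (h <= m)%MM.
Proof.
split=> [[s [sH ->]]|fH].
  elim: s sH => [|p s IH] sH m; first by rewrite big_nil msupp0.
  rewrite big_cons => /msuppD_le; rewrite mem_cat => /orP[|ms]; last first.
    by apply: IH ms => q qs; apply: sH; rewrite inE qs orbT.
  have [h hH ->] := sH p (mem_head _ _).
  move=> /msuppM_le/allpairsP[[k l] [_]]; rewrite msuppX inE => /eqP -> ->.
  by exists h => //; rewrite lem_addl.
apply: (@mpoly_term_ind (fun f => spans (V := S^o) (monomials (K := K) H) f)).
- by exists [::]; rewrite big_nil.
- move=> g h [s [sH ->]] [t [tH ->]]; exists (s ++ t); rewrite big_cat; split=> // p.
  by rewrite mem_cat => /orP[/sH|/tH].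
move=> m /fH[h hH hm]; exists [:: (f@_m *: 'X_[m - h], 'X_[h])]; split.
  by move=> p; rewrite inE => /eqP ->; exists h.
rewrite big_seq1 /= (_ : 'X_[m] = 'X_[m - h] * 'X_[h]) ?scalerAl //.
by rewrite -mpolyXD submK.
Qed.

Lemma mon_ideal_generated G : ideal_generated_by (mon_ideal G) (monomials (K := K) (mem G)).
Proof.
move=> f; rewrite mon_idealE spans_monomialsP; split=> [/allP fG m /fG/upP//|fG].
by apply/allP => m /fG/upP.
Qed.

Definition vars V : seq mon := [seq U_(i)%MM | i <- enum V].

Lemma up_vars V m : up (vars V) m = meets V m.
Proof.
apply/upP/meetsP => [[w /mapP[i iV ->] /mnm_lepP/(_ i)]|[i iV mi]].
  by rewrite mnm1E eqxx; exists i => //; rewrite -mem_enum.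
exists U_(i)%MM; first by apply/mapP; exists i; rewrite ?mem_enum.
by apply/mnm_lepP => j; rewrite mnm1E; case: eqP => [<-|].
Qed.

Lemma mon_ideal_varsE V f : (f \in mon_ideal (vars V)) = all (meets V) (msupp f).
Proof. by rewrite mon_idealE; apply: eq_all => m; rewrite up_vars. Qed.

(** An endomorphism of S with kernel P_V: primality of P_V then follows from S being a domain. *)
Definition kill V f : S := f \mPo [tuple if i \in V then 0 else 'X_i | i < n].

Lemma killX V m : kill V 'X_[m] = if meets V m then 0 else 'X_[m].
Proof.
rewrite /kill comp_mpolyX; case: meetsP => [[i iV mi]|nV].
  by rewrite (bigD1 i) //= tnth_mktuple iV expr0n eqn0Ngt mi mul0r.
rewrite [RHS]mpolyXE_id; apply: eq_bigr => i _; rewrite tnth_mktuple.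
case: ifP => // iV; case: (posnP (m i)) => [->|mi]; first by rewrite !expr0.
by case: nV; exists i.
Qed.

Lemma kill_coef V f m : (kill V f)@_m = if meets V m then 0 else f@_m.
Proof.
apply: (@mpoly_term_ind (fun f => (kill V f)@_m = if meets V m then 0 else f@_m)).
- by rewrite /kill comp_mpoly0 mcoeff0 if_same.
- by move=> g h eg eh; rewrite /kill comp_mpolyD !mcoeffD eg eh; case: ifP; rewrite ?addr0.
move=> k _; rewrite /kill comp_mpolyZ -/(kill V _) killX !mcoeffZ.
case: (eqVneq k m) => [->|km]; first by case: ifP; rewrite ?mcoeff0 ?mulr0.
by rewrite mcoeffX (negbTE km) mulr0 if_same; case: ifP;
  rewrite ?mcoeff0 ?mcoeffX ?(negbTE km) mulr0.
Qed.

Lemma mem_mon_ideal_vars V f : (f \in mon_ideal (vars V)) = (kill V f == 0).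
Proof.
rewrite mon_ideal_varsE; apply/allP/eqP => [fV|k0 m mf].
  apply/mpolyP => m; rewrite kill_coef mcoeff0; case: ifPn => // nV.
  by apply/eqP; rewrite mcoeff_eq0; apply: contra nV => /fV.
case: (boolP (meets V m)) => // nV; move: mf; rewrite mcoeff_msupp.
by have := congr1 (mcoeff m) k0; rewrite kill_coef (negbTE nV) mcoeff0 => ->; rewrite eqxx.
Qed.

Lemma mon_ideal_vars_prime V : monomial_prime (mon_ideal (vars V)).
Proof.
split.
- rewrite mon_ideal_varsE msupp1 /= andbT; apply/meetsP => -[i _].
  by rewrite mnm0E.
- move=> f g; rewrite !mem_mon_ideal_vars /kill rmorphM mulf_eq0.
  done.
exists V => f; rewrite (mon_ideal_generated (vars V)); split=> -[s [sV ->]];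
  exists s; split=> // p /sV.
  by case=> m /mapP[i iV ->] ->; exists i; rewrite // -mem_enum.
by case=> i iV ->; exists U_(i)%MM => //; apply/mapP; exists i; rewrite ?mem_enum.
Qed.

Lemma mon_ideal_vars_sub V W :
  {subset mon_ideal (vars V) <= mon_ideal (vars W)} -> V \subset W.
Proof.
move=> sVW; apply/subsetP => i iV; have := sVW 'X_i.
rewrite !mem_mon_idealX !up_vars => h.
have /h/meetsP[j jW] : meets V U_(i) by apply/meetsP; exists i; rewrite // mnm1E eqxx.
by rewrite mnm1E; case: eqP => // ->.
Qed.

(** Multiplication by x^m maps S into (M), is onto modulo (G), and pulls (G) back to (G) : x^m =
    P_V. *)
Lemma mon_ideal_step G M m V : up M =1 up (m :: G) ->
  (forall f : mon, up G (m + f)%MM = meets V f) ->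
  lmod_isomorphic (subquot (mon_ideal M) (mon_ideal G))
                  (quotmod (mon_ideal (vars V))).
Proof.
move=> eM colon.
pose phi (g : S^o) : S^o := g * 'X_[m].
have phi_lin : linear phi by move=> a x y; rewrite /phi mulrDl -scalerAl.
pose Phi : {linear S^o -> S^o} := HB.pack phi (GRing.isLinear.Build S S^o S^o *:%R phi phi_lin).
apply: (@subquot_isomorphic _ _ _ _ _ _ Phi) => [g|g|f].
- apply/allP => k; rewrite (perm_mem (msuppMX _ _)) => /mapP[l _ ->].
  by rewrite eM /up /= lem_addr.
- rewrite mon_ideal_varsE mon_idealE (perm_all _ (msuppMX _ _)) all_map.
  by apply: eq_all => k /=; rewrite colon.
rewrite mon_idealE (eq_all eM) => /allP fG.
apply: (@mpoly_term_ind (fun f => exists g, f - g * 'X_[m] \in mon_ideal G)).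
- by exists 0; rewrite mul0r subr0 rpred0.
- move=> g h [g' gG] [h' hG]; exists (g' + h').
  by rewrite mulrDl opprD addrACA; apply: rpredD.
move=> k /fG; rewrite /up /= => /orP[mk|kG].
  exists (f@_k *: 'X_[k - m]).
  by rewrite -scalerAl -mpolyXD submK // subrr rpred0.
exists 0; rewrite mul0r subr0 mon_idealE.
by apply/allP => l /msuppZ_le; rewrite msuppX inE => /eqP ->.
Qed.

(** Heights do not increase along the list, so an inclusion of an earlier prime in a later one is an
    equality by cardinality. *)
Lemma pretty_clean_of_steps (I : ideal n K) G (L : seq (mon * {set 'I_n})) :
  mon_ideal G =i I -> steps G L -> up (after G L) 0%MM ->
  pairwise (fun p q : mon * {set 'I_n} => #|q.2| <= #|p.2|)%N L -> pretty_clean I.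
Proof.
move=> GI sL oL dL; pose p0 : mon * {set 'I_n} := (0%MM, set0).
(* Steps are numbered from 0 but the primes of a filtration from 1, hence [j.-1]. *)
exists (size L), (fun j => mon_ideal (after G (take j L))),
  (fun j => mon_ideal (vars (nth p0 L j.-1).2)); split.
- by move=> f; rewrite take0 GI.
- move=> f; rewrite take_size !inE; apply/allP => m _.
  by apply: up_le oL; apply/mnm_lepP => i; rewrite mnm0E.
- move=> j jL f /allP fF; apply/allP => m /fF; apply: up_sub => w.
  rewrite (take_nth p0 jL) /after map_rcons !mem_cat mem_rcons inE.
  by case/orP=> ->; rewrite !orbT.
- move=> [//|j] /andP[_ jL] /=; split; first exact: mon_ideal_vars_prime.
  move: sL; rewrite -{1}(cat_take_drop j L) (drop_nth p0 jL).
  case/steps_cat=> _ [colon _]; apply: mon_ideal_step colon.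
  move=> f; rewrite (take_nth p0 jL) -cats1 -up_after_cons.
  by rewrite /up /after map_cat -catA.
move=> [//|i] [//|j] _ /andP[ij jL] /= /mon_ideal_vars_sub sV.
suff -> : (nth p0 L i).2 = (nth p0 L j).2 by [].
apply/eqP; rewrite eqEcard sV /=.
by apply: (pairwiseP p0 dL); rewrite ?inE //; apply: ltn_trans jL.
Qed.

End MonomialIdealsOfSeq.

(** * Dickson's lemma and minimal generators *)

Section Dickson.
Variable n : nat.
Local Notation mon := 'X_{1..n}.
Local Open Scope nat_scope.

(** Induction on the number k of exponents compared; for k = 0 any one element of P suffices. For
    the next exponent, take s from the induction hypothesis: it handles each m whose new exponent is
    at least the maximum over s. The remaining m fall into finitely many slices with that exponent
    fixed, each handled by induction. *)
Lemma dickson_up_to k (P : mon -> Prop) : exists s : seq mon,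
  (forall w, w \in s -> P w) /\
  forall m, P m -> exists2 w, w \in s & forall i : 'I_n, i < k -> w i <= m i.
Proof.
elim: k P => [|k IH] P.
  have [[w Pw]|nP] := classic (exists w, P w).
    by exists [:: w]; split=> [v|m _]; [rewrite inE => /eqP -> | exists w; rewrite ?mem_head].
  by exists [::]; split=> // m Pm; case: nP; exists m.
have [kn|nk] := ltnP k n; last first.
  have [s [sP sle]] := IH P; exists s; split=> // m /sle[w ws le].
  by exists w => // i _; apply: le; apply: leq_trans nk.
pose k' := Ordinal kn; have [s [sP sle]] := IH P.
have slices N : exists t : seq mon, (forall w, w \in t -> P w) /\
    forall m, P m -> m k' < N ->
    exists2 w, w \in t & forall i : 'I_n, i < k.+1 -> w i <= m i.
  elim: N => [|N [t [tP tle]]]; first by exists [::].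
  have [r [rP rle]] := IH (fun m => P m /\ m k' = N).
  exists (r ++ t); split=> [w|m Pm].
    by rewrite mem_cat => /orP[/rP[]|/tP].
  rewrite ltnS leq_eqVlt => /orP[/eqP mN|/(tle m Pm)[w wt le]].
    have [w wr le] := rle m (conj Pm mN); exists w; first by rewrite mem_cat wr.
    move=> i; rewrite ltnS leq_eqVlt => /orP[/eqP ik|/le //].
    have -> : i = k' by apply: val_inj.
    by rewrite mN (rP w wr).2.
  by exists w => //; rewrite mem_cat wt orbT.
have [t [tP tle]] := slices (\max_(w <- s) w k').
exists (s ++ t); split=> [w|m Pm]; first by rewrite mem_cat => /orP[/sP|/tP].
have [lt|ge] := ltnP (m k') (\max_(w <- s) w k').
  by have [w wt le] := tle m Pm lt; exists w => //; rewrite mem_cat wt orbT.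
have [w ws le] := sle m Pm; exists w; first by rewrite mem_cat ws.
move=> i; rewrite ltnS leq_eqVlt => /orP[/eqP ik|/le //].
have -> : i = k' by apply: val_inj.
by apply: leq_trans ge; apply: (leq_bigmax_seq (F := fun w : mon => w k')).
Qed.

Lemma dickson (P : mon -> Prop) : exists s : seq mon,
  (forall w, w \in s -> P w) /\ forall m, P m -> up s m.
Proof.
have [s [sP sle]] := dickson_up_to n P; exists s; split=> // m /sle[w ws le].
by apply/upP; exists w => //; apply/mnm_lepP => i; apply: le.
Qed.

Lemma minimal_elements (s : seq mon) : exists t : seq mon,
  [/\ {subset t <= s}, up t =1 up s & {in t &, forall v w, (v <= w)%MM -> v = w}].
Proof.
exists [seq w <- s | all (fun v => (v <= w)%MM ==> (v == w)) s]; split.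
- by move=> w; rewrite mem_filter => /andP[].
- move=> m; apply/idP/idP; first by apply: up_sub => w; rewrite mem_filter => /andP[].
  case/upP=> w; have [d] := ubnP (mdeg w); elim: d w => // d IH w lt ws wm.
  have [min|/allPn[v vs]] := boolP (all (fun v => (v <= w)%MM ==> (v == w)) s).
    by apply/upP; exists w; rewrite // mem_filter min.
  rewrite negb_imply => /andP[vw ne]; apply: IH vs (lepm_trans vw wm).
  have := mdegD (w - v) v; rewrite submK // => e.
  suff : mdeg (w - v)%MM != 0 by rewrite ltnS in lt; lia.
  rewrite mdeg_eq0; apply: contra ne => /eqP wv0.
  by have := submK vw; rewrite wv0 add0m => ->.
move=> v w; rewrite !mem_filter => /andP[_ vs] /andP[/allP min _] vw.
by apply/eqP; have /implyP := min v vs; apply.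
Qed.
End Dickson.

(** * Passing from the ideal to a sorted filtration *)

(** If H inside G generates I, each w in G is a multiple of some h in H, and h = w in an
    antichain. *)
Lemma minimal_monomial_generators_antichain (n : nat) (K : fieldType)
    (I : ideal n K) (G : seq 'X_{1..n}) :
  ideal_generated_by I (monomials (K := K) (mem G)) ->
  {in G &, forall v w, (v <= w)%MM -> v = w} ->
  minimal_monomial_generators I (mem G).
Proof.
move=> gen anti; split=> // H HG genH w; apply/idP/idP; first exact: HG.
move=> wG; have : 'X_[w] \in I.
  apply/gen/spans_monomialsP => m; rewrite msuppX inE => /eqP ->.
  by exists w; rewrite ?lepm_refl.
move/genH/spans_monomialsP/(_ w); rewrite msuppX mem_head => /(_ isT)[h hH hw].
by rewrite -(anti h w (HG h hH) wG hw).
Qed.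

Theorem theorem3p4 (n : nat) (K : fieldType) (I : ideal n K)
  (hI : monomial_ideal I) (hforest : forest_type I) : pretty_clean I.
Proof.
have [H genH] := hI; have [s [sH sup]] := dickson (fun m => m \in H).
have [G [Gs Gup anti]] := minimal_elements s.
have GI : mon_ideal K G =i I.
  move=> f; rewrite mon_idealE; apply/allP/idP => [fG|/genH/spans_monomialsP fH m /fH].
    apply/genH/spans_monomialsP => m /fG/upP[w wG wm].
    by exists w => //; apply/sH/Gs.
  by move=> [h hH hm]; rewrite Gup; apply: up_le hm (sup h hH).
have genG : ideal_generated_by I (monomials (K := K) (mem G)).
  by move=> f; rewrite -GI; apply: mon_ideal_generated.
have fG : forest G.
  exact: hforest (minimal_monomial_generators_antichain genG anti).
have [L [sL oL _ iL]] := forest_clean_steps fG.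
have [L' [pL dL' sL']] := steps_sort sL iL.
apply: pretty_clean_of_steps GI sL' _ dL'.
(* The last ideal depends only on the set of labels, which sorting preserves. *)
case/upP: oL => w wG w0; apply/upP; exists w => //.
by move: wG; rewrite !mem_cat (perm_mem (perm_map _ pL)).
Qed.
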